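(* Let $n\ge 1$. For every function $f:\{0,1\}^n\to\mathbb{N}$ one has $\mathrm{BP}_1(f)\ge \widehat{P^+}(f)$. Moreover, if $f:\{0,1\}^n\to\{0,1\}$ is Boolean, then $\mathrm{BP}_1(f)\ge \widehat{P}(f)$.
   Context: For $f:\{0,1\}^n\to\mathbb{N}$ and $A\subseteq[n]$, $f_A$ denotes the $2^{|A|}\times 2^{n-|A|}$ matrix whose rows are indexed by $\alpha\in\{0,1\}^A$, columns by $\beta\in\{0,1\}^{[n]\setminus A}$, with entry $f(\alpha,\beta)$ (the input agreeing with $\alpha$ on $A$ and with $\beta$ off $A$). A matrix $M\in\mathbb{N}^{a\times b}$ is a rectangle if $M(i,j)=g_i h_j$ for some $g\in\{0,1\}^a$, $h\in\mathbb{N}^b$. A function $g:\{0,1\}^n\to\mathbb{N}$ is an $A$-rectangle if $g_A$ is a rectangle, and a $k$-rectangle if it is an $A$-rectangle for some $A$ with $|A|=k$. Two functions $g,h$ are orthogonal if $g\cdot h$ is identically $0$. $P^+(f,k)$ is the minimum $r$ such that $f$ is the integer sum of $r$ pairwise orthogonal $k$-rectangles; $\widehat{P^+}(f)=\max_{k\in[n]}P^+(f,k)$. For Boolean $f$, $\widehat{P}(f)=\max\{\widehat{P^+}(f),\widehat{P^+}(\neg f)\}$. A deterministic branching program is a DAG with one source, sink nodes labelled by output values (in $\{0,1\}$ for Boolean functions, in $\mathbb{N}$ for $\mathbb{N}$-valued functions), and each non-sink node labelled by a variable $x_i$ with two outgoing edges labelled $x_i=0$ and $x_i=1$; it computes $f$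 if the path followed by each input $x$ ends at a sink labelled $f(x)$. Its size is the number of nodes. It is (syntactic) read-once if each variable appears at most once on every source-to-sink path. $\mathrm{BP}_1(f)$ is the minimum size of a read-once deterministic branching program computing $f$. *)

(* Defs.v *)
From mathcomp Require Import all_boot.
From mathcomp Require Import matrix.
From mathcomp Require Import boolp.

Set Implicit Arguments.
Unset Strict Implicit.
Unset Printing Implicit Defensive.

Definition cube (n : nat) := {ffun 'I_n -> bool}.

Definition is_rectangle (a b : nat) (M : 'M[nat]_(a, b)) : Prop :=
  exists (g : 'I_a -> bool) (h : 'I_b -> nat), forall i j, M i j = g i * h j.

Section Rectangles.
Variable n : nat.
Implicit Types (A : {set 'I_n}) (f g h : cube n -> nat).

Definition row_cube A := {ffun {i : 'I_n | i \in A} -> bool}.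
Definition col_cube A := {ffun {i : 'I_n | i \notin A} -> bool}.

Definition merge A (a : row_cube A) (b : col_cube A) : cube n :=
  [ffun i => match boolP (i \in A) with
             | AltTrue iA => a (exist _ i iA)
             | AltFalse iA => b (exist _ i iA)
             end].

(* Matrices have numbered rows and columns: [enum_val] turns these numbers into
   the assignments on A and off A that index the matrix f_A. *)
Definition cut_mx f A : 'M[nat]_(#|row_cube A|, #|col_cube A|) :=
  (\matrix_(i, j) f (merge (enum_val i) (enum_val j)))%R.

Definition A_rectangle A g : Prop := is_rectangle (cut_mx g A).

Definition k_rectangle (k : nat) g : Prop :=
  exists A, #|A| = k /\ A_rectangle A g.

Definition orthogonal g h : Prop := forall x, g x * h x = 0.

Definition rectangle_partition f (k r : nat) : Prop :=
  exists g : 'I_r -> cube n -> nat,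
    [/\ forall i, k_rectangle k (g i),
        forall i j, i != j -> orthogonal (g i) (g j)
      & forall x, f x = \sum_(i < r) g i x].

Lemma merge_in A (a : row_cube A) (b : col_cube A) i (iA : i \in A) :
  merge a b i = a (exist _ i iA).
Proof.
rewrite ffunE; case: {-}_ / boolP => iA'; last by case/negP: (iA').
by congr (a _); apply: val_inj.
Qed.

Lemma merge_notin A (a : row_cube A) (b : col_cube A) i (iA : i \notin A) :
  merge a b i = b (exist _ i iA).
Proof.
rewrite ffunE; case: {-}_ / boolP => iA'; first by case/negP: (iA).
by congr (b _); apply: val_inj.
Qed.

Lemma merge_eq A (a : row_cube A) (b : col_cube A) (y : cube n) :
  (merge a b == y) =
  (a == [ffun i => y (val i)]) && (b == [ffun i => y (val i)]).
Proof.
apply/eqP/andP => [<-|[/eqP-> /eqP->]].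
  split; apply/eqP/ffunP => -[i iA]; rewrite ffunE /=.
    by rewrite merge_in.
  by rewrite merge_notin.
apply/ffunP=> i; case: (boolP (i \in A)) => iA.
  by rewrite merge_in ffunE.
by rewrite merge_notin ffunE.
Qed.

(* The functions supported on a single point show that a partition exists. *)
Lemma rectangle_partition_ex f (k : 'I_n.+1) :
  exists r, `[< rectangle_partition f k r >].
Proof.
exists #|cube n|; apply/asboolP.
exists (fun i x => (x == enum_val i) * f (enum_val i)); split=> [i|i j ij x|x].
- exists [set widen_ord (ltn_ord k : k <= n) j | j in 'I_k]; split.
    rewrite card_imset ?card_ord // => a b /(congr1 val) /= ab.
    exact: val_inj.
  set A := [set _ | _ in _]; set y := enum_val i.
  exists (fun a => enum_val a == [ffun i => y (val i)]).
  exists (fun b => (enum_val b == [ffun i => y (val i)]) * f y) => a b.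
  by rewrite mxE merge_eq mulnA mulnb.
- have [->|_] := eqVneq x (enum_val i); last by rewrite mul0n.
  have /negPf-> : enum_val i != enum_val j by rewrite (inj_eq enum_val_inj).
  by rewrite mul0n muln0.
- rewrite (bigD1 (enum_rank x)) //= enum_rankK eqxx mul1n big1 ?addn0 // => i.
  by rewrite -(inj_eq enum_val_inj) enum_rankK eq_sym => /negPf->.
Qed.

(* The index k ranges over 0, ..., n: for k > n there is no k-rectangle. *)
Definition Pplus f (k : 'I_n.+1) : nat := ex_minn (rectangle_partition_ex f k).

Definition Pplus_hat f : nat := \max_(k < n.+1 | 0 < k) Pplus f k.

Definition P_hat (f : cube n -> bool) : nat :=
  maxn (Pplus_hat (fun x => f x : nat)) (Pplus_hat (fun x => ~~ f x : nat)).

End Rectangles.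

(* [Query i v0 v1] reads x_i and goes to v0 if x_i = 0, to v1 if x_i = 1. *)
Variant instruction (n : nat) (T V : Type) :=
  | Sink of T
  | Query of 'I_n & V & V.
Arguments Sink {n T V}.
Arguments Query {n T V}.

Section Instructions.
Variables (n : nat) (T : Type) (V : finType) (instr : V -> instruction n T V).

Definition edge : rel V := fun u v =>
  if instr u is Query _ v0 v1 then (v == v0) || (v == v1) else false.

Definition follows (x : cube n) : rel V := fun u v =>
  if instr u is Query i v0 v1 then v == (if x i then v1 else v0) else false.

Definition is_sink (u : V) : bool := if instr u is Sink _ then true else false.

Definition queried (u : V) : option 'I_n :=
  if instr u is Query i _ _ then Some i else None.

Definition acyclic : Prop := forall c : seq V, cycle edge c -> c = [::].

Definition unique_source (s : V) : Prop :=
  forall v, v = s <-> (forall u, ~~ edge u v).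

End Instructions.

Record branching_program (n : nat) (T : Type) := BranchingProgram {
  bp_node : finType;
  bp_instr : bp_node -> instruction n T bp_node;
  bp_source : bp_node;
  bp_acyclic : acyclic bp_instr;
  bp_sourceP : unique_source bp_instr bp_source }.

Section BranchingPrograms.
Variables (n : nat) (T : Type).
Implicit Types (B : branching_program n T) (f : cube n -> T).

Definition bp_size B : nat := #|bp_node B|.

Definition computes B f : Prop :=
  forall x, exists2 p : seq (bp_node B),
    path (follows (@bp_instr _ _ B) x) (bp_source B) p
    & bp_instr (last (bp_source B) p) = Sink (f x).

Definition read_once B : Prop :=
  forall p : seq (bp_node B),
    path (edge (@bp_instr _ _ B)) (bp_source B) p ->
    is_sink (@bp_instr _ _ B) (last (bp_source B) p) ->
    uniq (pmap (queried (@bp_instr _ _ B)) (bp_source B :: p)).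

Definition read_once_size f (m : nat) : Prop :=
  exists B, [/\ read_once B, computes B f & bp_size B = m].

End BranchingPrograms.

(* The complete decision tree reading x_0, ..., x_(n-1) in this order. Its nodes
   at level j are the inputs that vanish from coordinate j on. *)
Section DecisionTree.
Variables (n : nat) (T : Type) (f : cube n -> T).

Let node : finType :=
  {p : 'I_n.+1 * cube n | [forall i : 'I_n, (p.1 <= i) ==> ~~ p.2 i]}.

Let trunc (j : nat) (y : cube n) : cube n := [ffun i : 'I_n => (i < j) && y i].

Fact dt_nodeP (j : 'I_n.+1) y :
  [forall i : 'I_n, ((j, trunc j y).1 <= i) ==> ~~ (j, trunc j y).2 i].
Proof. by apply/forallP=> i; apply/implyP=> /= ji; rewrite ffunE ltnNge ji. Qed.

Let mk (j : 'I_n.+1) y : node := exist _ (j, trunc j y) (dt_nodeP j y).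
Let level (u : node) : 'I_n.+1 := (val u).1.
Let point (u : node) : cube n := (val u).2.
Let set1 (i : 'I_n) (y : cube n) : cube n := [ffun k => (k == i) || y k].

Definition dt_instr (u : node) : instruction n T node :=
  if insub (level u : nat) is Some i
  then Query i (mk (lift ord0 i) (point u)) (mk (lift ord0 i) (set1 i (point u)))
  else Sink (f (point u)).

Let edge_level u v : edge dt_instr u v -> level v = (level u).+1 :> nat.
Proof.
rewrite /edge /dt_instr; case: insubP => //= i _ <-.
by case/orP=> /eqP->.
Qed.

Let path_level u p : path (edge dt_instr) u p ->
  level (last u p) = level u + size p :> nat.
Proof.
elim: p u => [|v p IH] u /=; first by rewrite addn0.
by case/andP=> /edge_level uv /IH->; rewrite uv addSnnS.
Qed.

Fact dt_acyclic : acyclic dt_instr.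
Proof.
case=> // u c /path_level; rewrite last_rcons size_rcons => /eqP.
by rewrite -{1}[level u : nat]addn0 eqn_add2l.
Qed.

Let trunc_point u : trunc (level u) (point u) = point u.
Proof.
apply/ffunP=> i; rewrite ffunE; have [//|ui] := ltnP.
by have /forallP/(_ i)/implyP/(_ ui)/negPf-> := valP u.
Qed.

Let mk_point u : mk (level u) (point u) = u.
Proof. by apply: val_inj; rewrite /= trunc_point; case: (u) => -[]. Qed.

Let dt_instr_mk (i : 'I_n) (j : 'I_n.+1) y : j = i :> nat ->
  dt_instr (mk j y) = Query i (mk (lift ord0 i) (trunc i y))
                              (mk (lift ord0 i) (set1 i (trunc i y))).
Proof.
move=> ji; have lt_jn : j < n by rewrite ji.
have -> : i = Ordinal lt_jn by apply: val_inj; rewrite /= ji.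
by rewrite /dt_instr /level /point /= insubT.
Qed.

Let step (i : 'I_n) (y : cube n) :
  mk (lift ord0 i) (if y i then set1 i (trunc i y) else trunc i y) =
  mk (lift ord0 i) y.
Proof.
apply: val_inj; congr (_, _); apply/ffunP => k; rewrite !ffunE /= /bump /=.
rewrite add1n ltnS; case: ifP => yi; rewrite !ffunE.
  have [->|ki] := eqVneq k i; first by rewrite leqnn yi.
  by rewrite [k < i]ltn_neqAle ki; case: (k <= i).
have [->|ki] := eqVneq k i; first by rewrite ltnn yi andbF.
by rewrite [k < i]ltn_neqAle ki; case: (k <= i).
Qed.

Fact dt_source : unique_source dt_instr (mk ord0 [ffun=> false]).
Proof.
move=> v; split=> [-> u|noedge]; first by apply/negP => /edge_level.
case: (unliftP ord0 (level v)) => [i vi|v0]; last first.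
  by rewrite -[v]mk_point v0; apply: val_inj.
have := noedge (mk (widen_ord (leqnSn n) i) (point v)).
rewrite /edge (@dt_instr_mk i) // -{1 3}[v]mk_point vi -step.
by case: ifP => _; rewrite eqxx ?orbT.
Qed.

Definition decision_tree : branching_program n T :=
  BranchingProgram dt_acyclic dt_source.

Let queried_ge u p : path (edge dt_instr) u p ->
  uniq (pmap (queried dt_instr) (u :: p)) &&
  all (fun i : 'I_n => level u <= i) (pmap (queried dt_instr) (u :: p)).
Proof.
have lvl w i : queried dt_instr w = Some i -> level w = i :> nat.
  by rewrite /queried /dt_instr; case: insubP => //= j _ <- [->].
elim: p u => [|v p IH] u.
  by move=> _ /=; case E: (queried _ u) => [i|] //=; rewrite (lvl _ _ E) leqnn.
move=> /= /andP[/edge_level uv /IH /andP[U /allP L]].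
have Lu : all (fun i : 'I_n => level u < i)
              (pmap (queried dt_instr) (v :: p)).
  by apply/allP => i /L; rewrite uv.
case E: (queried _ u) => [i|] /=; last first.
  by rewrite U /=; apply: sub_all Lu => i; apply: ltnW.
rewrite U (lvl _ _ E) leqnn andbT /=; apply/andP; split.
  by apply/negP => /(allP Lu); rewrite (lvl _ _ E) ltnn.
by apply: sub_all Lu => k; rewrite (lvl _ _ E); apply: ltnW.
Qed.

Lemma decision_tree_read_once : read_once decision_tree.
Proof. by move=> p /queried_ge/andP[]. Qed.

Lemma decision_tree_computes : computes decision_tree f.
Proof.
move=> x; rewrite /=.
have -> : mk ord0 [ffun=> false] = mk ord0 x.
  exact: val_inj.
have [m] := ubnP (n - @ord0 n); elim: m (ord0 : 'I_n.+1) => // m IH j.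
rewrite ltnS => le_m; have [lt_jn|le_nj] := ltnP j n; last first.
  exists [::] => //=; rewrite /dt_instr insubF ?ltnNge ?le_nj //.
  congr (Sink (f _)); apply/ffunP => i.
  by rewrite ffunE (leq_trans (ltn_ord i) le_nj).
have [|p xp xl] := IH (lift ord0 (Ordinal lt_jn)).
  by rewrite /= /bump /= add1n (leq_trans _ le_m) // ltn_sub2l.
exists (mk (lift ord0 (Ordinal lt_jn)) x :: p) => //=.
rewrite xp andbT /follows (@dt_instr_mk (Ordinal lt_jn)) //.
by rewrite -(step _ x); case: ifP.
Qed.

End DecisionTree.

Lemma read_once_size_ex n T (f : cube n -> T) :
  exists m, `[< read_once_size f m >].
Proof.
exists (bp_size (decision_tree f)); apply/asboolP; exists (decision_tree f).
by split=> //; [apply: decision_tree_read_once | apply: decision_tree_computes].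
Qed.

Definition BP1 (n : nat) (T : Type) (f : cube n -> T) : nat :=
  ex_minn (read_once_size_ex f).

(* Main.v *)
(** Fix [k] and call a node late if at most [n - k] variables are queried at
    the nodes reachable from it, early otherwise. Every computation crosses
    exactly one edge from an early to a late node, unless the source is late. By
    the read-once property the inputs crossing a given such edge form a
    rectangle for every [A] of size [k] that contains the variables queried up
    to that edge and avoids those queried after it. There are at most as many of
    these edges as nodes: with [E] early nodes, [2E] edges leave early nodes, and
    at least [E - 1] of them stay among the early nodes because each early node
    other than the source has an incoming edge; some sink is late, so at most
    [E + 1] crossing edges remain, which is at most the number of nodes. *)

Require Import Defs.
From mathcomp Require Import matrix boolp.
From mathcomp Require Import all_boot.
From mathcomp Require Import zify.

Set Implicit Arguments.
Unset Strict Implicit.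
Unset Printing Implicit Defensive.

(** * Reachability in finite relations and sets of intermediate size *)

Lemma connect_step (V : finType) (e : rel V) u v :
  connect e u v -> u = v \/ exists2 w, e u w & connect e w v.
Proof.
case/connectP=> -[|w p] /=; first by move=> _ ->; left.
by case/andP=> uw wp ->; right; exists w => //; apply/connectP; exists p.
Qed.

(** From [s] there is only one walk, so one of [u] and [v] lies further along it than the other. *)
Lemma connect_functional (V : finType) (e : rel V) s u v :
    (forall a b c, e a b -> e a c -> b = c) ->
  connect e s u -> connect e s v -> connect e u v || connect e v u.
Proof.
move=> efun /connectP[p]; elim: p s => [|a p IH] s /=.
  by move=> _ -> ->.
case/andP=> sa ap lu; case/connect_step=> [<-|[b sb bv]].
  apply/orP; right; apply: (connect_trans (connect1 sa)).
  by apply/connectP; exists p.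
by apply: (IH a) => //; rewrite (efun _ _ _ sa sb).
Qed.

Lemma subset_between (T : finType) (D E : {set T}) k :
    D \subset E -> #|D| <= k <= #|E| ->
  exists A : {set T}, [/\ D \subset A, A \subset E & #|A| = k].
Proof.
move=> DE /andP[]; elim: k => [|k IH] Dk kE.
  by exists D; split=> //; lia.
have [Dk'|kD] := leqP #|D| k; last by exists D; split=> //; lia.
have [A [DA AE cA]] := IH Dk' (ltnW kE).
have [x xE xA] : exists2 x, x \in E & x \notin A.
  by apply/subsetPn/negP => /subset_leq_card; lia.
exists (x |: A); split; last by rewrite cardsU1 xA cA.
  exact: subset_trans DA (subsetUr _ _).
by rewrite subUset sub1set xE.
Qed.

(** * Rectangles cut out by a Boolean condition *)

Lemma restrict_A_rectangle n (A : {set 'I_n}) (R : cube n -> bool)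
    (f : cube n -> nat) :
    (forall x y : cube n, {in A, x =1 y} -> R x -> R y) ->
    (forall x y : cube n, R x -> R y -> {in ~: A, x =1 y} -> f x = f y) ->
  A_rectangle A (fun x => R x * f x).
Proof.
move=> RA fA.
(* As [R] depends on the row only, it serves as the 0/1 factor. Where [R] holds, [f] depends on the
   column only, so any row satisfying [R] gives its value; the default 0 is never met by a row whose
   factor is 1. *)
exists (fun i => [exists j : col_cube A, R (Defs.merge (enum_val i) j)]).
exists (fun j => if [pick i : row_cube A | R (Defs.merge i (enum_val j))] is Some i
                 then f (Defs.merge i (enum_val j)) else 0) => i j.
rewrite mxE; set a := enum_val i; set b := enum_val j.
case Rab: (R _); last first.
  have [/existsP[b' Rab']|//] := boolP [exists b', R (Defs.merge a b')].
  suff : R (Defs.merge a b) by rewrite Rab.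
  by apply: RA Rab' => l lA; rewrite !merge_in.
have -> : [exists b', R (Defs.merge a b')] by apply/existsP; exists b.
rewrite !mul1n; case: pickP => [a' Ra'b|/(_ a)]; last by rewrite Rab.
by apply: fA => // l; rewrite inE => lA; rewrite !merge_notin.
Qed.

(** The cardinality bounds leave room for a set [A] of size [k] with [D] inside and [C] outside;
    then [R] is a row condition and [f] a column value. *)
Lemma between_k_rectangle n (D C : {set 'I_n}) k (R : cube n -> bool)
    (f : cube n -> nat) :
    [disjoint D & C] -> #|D| <= k -> #|C| + k <= n ->
    (forall x y : cube n, {in D, x =1 y} -> R x -> R y) ->
    (forall x y : cube n, R x -> R y -> {in C, x =1 y} -> f x = f y) ->
  k_rectangle k (fun x => R x * f x).
Proof.
rewrite disjoints_subset => DC Dk kC RD fC.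
have kC' : #|D| <= k <= #|~: C|.
  by rewrite Dk; have := cardsC C; rewrite card_ord; lia.
have [A [DA AC cA]] := subset_between DC kC'.
exists A; split=> //; apply: restrict_A_rectangle => x y.
  by move=> xy; apply: RD => l /(subsetP DA); apply: xy.
move=> Rx Ry xy; apply: fC => // l lC; apply: xy; rewrite inE.
by apply/negP => /(subsetP AC); rewrite inE lC.
Qed.

(** * Paths and queried variables in a read-once program *)

Section ReadOnce.
Variables (n : nat) (T : Type) (B : branching_program n T).
Local Notation V := (bp_node B).
Local Notation instr := (@bp_instr _ _ B).
Local Notation s := (bp_source B).
Local Notation E := (edge instr).
Hypothesis B_ro : read_once B.

(* Junk value [u] at a sink. *)
Definition successor (u : V) (b : bool) : V :=
  if instr u is Query _ v0 v1 then if b then v1 else v0 else u.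

Lemma edgeP u v :
  reflect (exists i b, queried instr u = Some i /\ v = successor u b) (E u v).
Proof.
rewrite /edge /queried /successor; case: (instr u) => [t|i v0 v1] /=.
  by constructor=> -[i [b []]].
apply: (iffP orP) => [[/eqP->|/eqP->]|[j [[] [_ ->]]]].
- by exists i, false.
- by exists i, true.
- by right.
- by left.
Qed.

Lemma followsP (x : cube n) u v :
  reflect (exists2 i, queried instr u = Some i & v = successor u (x i))
          (follows instr x u v).
Proof.
rewrite /follows /queried /successor; case: (instr u) => [t|i v0 v1] /=.
  by constructor=> -[].
by apply: (iffP eqP) => [->|[j [<-]]]; first by exists i.
Qed.

Lemma follows_edge x u v : follows instr x u v -> E u v.
Proof. by case/followsP=> i ui ->; apply/edgeP; exists i, (x i). Qed.

Lemma connect_follows_edge x u v :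
  connect (follows instr x) u v -> connect E u v.
Proof.
by apply: connect_sub => a b /follows_edge ab; apply: connect1.
Qed.

Lemma follows_functional x a b c :
  follows instr x a b -> follows instr x a c -> b = c.
Proof. by case/followsP=> i ai -> /followsP[j]; rewrite ai => -[<-]. Qed.

Lemma edge_back u v : E u v -> connect E v u -> False.
Proof.
move=> uv /connectP[p vp lu].
suff /bp_acyclic : cycle E (v :: p) by [].
by rewrite /= rcons_path vp -lu.
Qed.

(** Induction on the number of nodes that reach [u]: by acyclicity fewer nodes reach a predecessor,
    and only the source has none. *)
Lemma connect_from_source u : connect E s u.
Proof.
have [m] := ubnP #|[set w | connect E w u]|.
elim: m u => // m IH u; rewrite ltnS => um.
have [->|su] := eqVneq u s; first exact: connect0.
have [w wu] : exists w, E w u.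
  apply: contrapT => no; case/eqP: su; apply/(bp_sourceP u) => w.
  by apply/negP => wu; apply: no; exists w.
apply: connect_trans (connect1 wu); apply: IH; apply: leq_trans um.
apply/proper_card/properP; split.
  apply/subsetP => a; rewrite !inE => aw.
  exact: connect_trans aw (connect1 wu).
exists u; rewrite !inE ?connect0 //.
by apply/negP; apply: edge_back.
Qed.

Lemma connect_to_sink u : exists2 t, connect E u t & is_sink instr t.
Proof.
have [m] := ubnP #|[set w | connect E u w]|.
elim: m u => // m IH u; rewrite ltnS => um.
case ui: (instr u) => [t|i v0 v1].
  by exists u; rewrite ?connect0 // /is_sink ui.
have uv : E u v0 by rewrite /edge ui eqxx.
have [|t vt tS] := IH v0; last first.
  by exists t => //; apply: connect_trans (connect1 uv) vt.
apply: leq_trans um; apply/proper_card/properP; split.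
  apply/subsetP => a; rewrite !inE => va.
  exact: connect_trans (connect1 uv) va.
exists u; rewrite !inE ?connect0 //.
by apply/negP; apply: edge_back.
Qed.

(** The read-once condition concerns full paths only, so the segment from [w] to [w'] is extended
    back to the source and on to a sink; [i] would be queried twice there. *)
Lemma no_requery w a w' i : queried instr w = Some i -> E w a ->
  connect E a w' -> queried instr w' = Some i -> False.
Proof.
move=> wi wa /connectP[q aq lw'] w'i.
have /connectP[p sp lw] := connect_from_source w.
have [t /connectP[r w'r lt] tS] := connect_to_sink w'.
have path_pqr : path E s (p ++ (a :: q) ++ r).
  by rewrite !cat_path /= -lw wa sp aq -lw'.
have last_pqr : last s (p ++ (a :: q) ++ r) = t by rewrite !last_cat /= -lw'.
have := B_ro path_pqr; rewrite last_pqr => /(_ tS).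
rewrite -cat_cons !pmap_cat cat_uniq => /and3P[_ /hasPn no _].
have /no/negP[] : i \in pmap (queried instr) (a :: q) ++ pmap (queried instr) r.
  by rewrite mem_cat mem_pmap -w'i map_f // lw' mem_last.
suff : i \in pmap (queried instr) (s :: p) by [].
by rewrite mem_pmap -wi map_f // lw mem_last.
Qed.

(** Reachability is reflexive, so the variable queried at [u] itself belongs both to this set and to
    [queried_after u]. *)
Definition queried_before (u : V) : {set 'I_n} :=
  [set i | [exists w, (queried instr w == Some i) && connect E w u]].

Definition queried_after (u : V) : {set 'I_n} :=
  [set i | [exists w, (queried instr w == Some i) && connect E u w]].

Lemma queried_beforeP u i :
  reflect (exists2 w, queried instr w = Some i & connect E w u)
          (i \in queried_before u).
Proof.
rewrite inE; apply: (iffP existsP) => [[w /andP[/eqP]]|[w wi wu]]; exists w => //.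
by rewrite wi eqxx.
Qed.

Lemma queried_afterP u i :
  reflect (exists2 w, queried instr w = Some i & connect E u w)
          (i \in queried_after u).
Proof.
rewrite inE; apply: (iffP existsP) => [[w /andP[/eqP]]|[w wi wu]]; exists w => //.
by rewrite wi eqxx.
Qed.

Lemma queried_after_sub u v :
  connect E u v -> queried_after v \subset queried_after u.
Proof.
move=> uv; apply/subsetP => i /queried_afterP[w wi vw].
by apply/queried_afterP; exists w => //; apply: connect_trans uv vw.
Qed.

Lemma disjoint_queried u v : E u v ->
  [disjoint queried_before u & queried_after v].
Proof.
move=> uv; apply/pred0P => i /=; apply/negP => /andP[].
case/queried_beforeP=> w wi wu /queried_afterP[w' w'i vw'].
have [wu'|[a wa au]] := connect_step wu.
  by apply: (no_requery wi _ vw' w'i); rewrite wu'.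
apply: (no_requery wi wa _ w'i).
exact: connect_trans au (connect_trans (connect1 uv) vw').
Qed.

(** The two sets share at most the variable queried at [u], since any other common one would be
    queried twice on a path; this accounts for the extra 1. *)
Lemma card_queried u : #|queried_before u| + #|queried_after u| <= n.+1.
Proof.
rewrite -cardsUI -addn1 leq_add //.
  by rewrite -[leqRHS]card_ord max_card.
apply/card_le1_eqP => i j.
suff U l : l \in queried_before u :&: queried_after u -> queried instr u = Some l.
  by move=> /U ui /U; rewrite ui => -[].
case/setIP=> /queried_beforeP[w wl wu] /queried_afterP[w' w'l uw'].
have [<-//|[a wa au]] := connect_step wu.
by case: (no_requery wl wa (connect_trans au uw') w'l).
Qed.

(** Every answer used on the way to [u] concerns a variable of [queried_before u], so [y] is steered
    along the same path. *)
Lemma connect_follows_before (x y : cube n) a u : {in queried_before u, x =1 y} ->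
  connect (follows instr x) a u -> connect (follows instr y) a u.
Proof.
move=> xy /connectP[p]; elim: p a => [|c p IH] a /=.
  by move=> _ ->; apply: connect0.
case/andP=> ac cp lu; apply: connect_trans (IH c cp lu).
have au : connect E a u.
  apply: connect_trans (connect1 (follows_edge ac)) _.
  by apply: (@connect_follows_edge x); apply/connectP; exists p.
case/followsP: ac => i ai ->; apply/connect1/followsP; exists i => //.
by rewrite xy //; apply/queried_beforeP; exists a.
Qed.

Lemma connect_follows_after (x y : cube n) v t : {in queried_after v, x =1 y} ->
  connect (follows instr x) v t -> connect (follows instr y) v t.
Proof.
move=> xy /connectP[p]; elim: p v xy => [|c p IH] v xy /=.
  by move=> _ ->; apply: connect0.
case/andP=> vc cp lt.
have xyc : {in queried_after c, x =1 y}.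
  move=> i ic; apply/xy/(subsetP (queried_after_sub _) _ ic).
  exact/connect1/follows_edge/vc.
apply: connect_trans (IH c xyc cp lt).
case/followsP: vc => i vi ->; apply/connect1/followsP; exists i => //.
by rewrite xy //; apply/queried_afterP; exists v.
Qed.

(** * Values computed from an intermediate node *)

Variable f : cube n -> T.
Hypothesis B_f : computes B f.

(** The walk of [x] is unique and cannot leave a sink, so [t] is the sink where the computation of
    [f x] ends. *)
Lemma connect_value x v t : connect (follows instr x) s v ->
  connect (follows instr x) v t -> is_sink instr t -> instr t = Sink (f x).
Proof.
move=> sv vt tS; have [p sp lp] := B_f x; set t' := last s p in lp.
have st' : connect (follows instr x) s t' by apply/connectP; exists p.
have sinkE a b : is_sink instr a -> connect (follows instr x) a b -> a = b.
  move=> aS /connect_step[//|[c /followsP[i]]].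
  by move: aS; rewrite /is_sink /queried; case: (instr a).
have t'S : is_sink instr t' by rewrite /is_sink lp.
have := connect_functional (@follows_functional x) (connect_trans sv vt) st'.
by case/orP=> [/(sinkE _ _ tS)->|/(sinkE _ _ t'S)<-].
Qed.

Lemma follows_to_sink x v : connect (follows instr x) s v ->
  exists2 t, connect (follows instr x) v t & is_sink instr t.
Proof.
move=> sv; have [p sp lp] := B_f x; set t := last s p in lp.
have st : connect (follows instr x) s t by apply/connectP; exists p.
have tS : is_sink instr t by rewrite /is_sink lp.
have /orP[vt|tv] := connect_functional (@follows_functional x) sv st.
  by exists t.
case/connect_step: tv => [<-|[c /followsP[i]]]; first by exists t.
by move: tS; rewrite /is_sink /queried; case: (instr t).
Qed.

Lemma value_after (x y : cube n) v :
    connect (follows instr x) s v -> connect (follows instr y) s v ->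
  {in queried_after v, x =1 y} -> f x = f y.
Proof.
move=> sxv syv xy; have [t vt tS] := follows_to_sink sxv.
have := connect_value syv (connect_follows_after xy vt) tS.
by rewrite (connect_value sxv vt tS) => -[].
Qed.

(** * Early nodes and crossing edges *)

Variables (k : nat) (le_kn : k <= n).

(** The condition that more than $n - k$ variables are queried from [u] on, stated without truncated
    subtraction. *)
Definition early (u : V) : bool := n < #|queried_after u| + k.

Lemma early_sink t : is_sink instr t -> ~~ early t.
Proof.
move=> tS; rewrite /early -leqNgt (_ : queried_after t = set0) ?cards0 //.
apply/setP => i; rewrite in_set0; apply/negP => /queried_afterP[w wi tw].
have [tw'|[a]] := connect_step tw.
  by move: tS wi; rewrite -tw' /is_sink /queried; case: (instr t).
by move: tS; rewrite /is_sink /edge; case: (instr t).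
Qed.

Lemma early_queried u : early u -> exists i, queried instr u = Some i.
Proof.
move=> uE; have /contraL/(_ uE) := @early_sink u.
by rewrite /is_sink /queried; case: (instr u) => // i; exists i.
Qed.

Lemma early_connect u v : connect E u v -> early v -> early u.
Proof.
by move=> /queried_after_sub/subset_leq_card; rewrite /early; lia.
Qed.

(** An edge is a node paired with an answer, so two edges with the same ends count separately. *)
Definition crossing : {set V * bool} :=
  [set e | early e.1 && ~~ early (successor e.1 e.2)].

Definition crosses (e : V * bool) (x : cube n) : bool :=
  connect (follows instr x) s e.1 &&
  (if queried instr e.1 is Some i then x i == e.2 else false).

Lemma crosses_connect e x : crosses e x ->
  connect (follows instr x) s (successor e.1 e.2).
Proof.
case/andP=> su; case ui: queried => [i|//] /eqP xi.
apply: connect_trans su _; apply/connect1/followsP; exists i => //.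
by rewrite xi.
Qed.

Lemma card_crossing : early s -> #|crossing| <= #|V|.
Proof.
move=> sE; pose Es := [set u | early u].
have cEs : #|setX Es [set: bool]| = 2 * #|Es|.
  by rewrite cardsX cardsT card_bool mulnC.
pose inner := setX Es [set: bool] :\: crossing.
have crossS : crossing \subset setX Es [set: bool].
  by apply/subsetP => -[u b]; rewrite !inE /= => /andP[->].
have innerS : Es :\ s \subset [set successor e.1 e.2 | e in inner].
  apply/subsetP => v; rewrite !inE => /andP[vs vE].
  have [u uv] : exists u, E u v.
    case/connectP: (connect_from_source v) => p.
    case/lastP: p => [_ /= vs'|p z]; first by rewrite vs' eqxx in vs.
    by rewrite rcons_path last_rcons => /andP[_ zv] ->; exists (last s p).
  (* The tail [u] reaches the early node [v], so it is early too and this edge does not cross. *)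
  case/edgeP: (uv) => i [b [_ vE']]; apply/imsetP; exists (u, b) => //=.
  rewrite !inE /= (early_connect (connect1 uv) vE) /=.
  by rewrite -vE' vE.
have := leq_trans (subset_leq_card innerS) (leq_imset_card _ _).
have : #|Es| = #|Es :\ s|.+1 by rewrite (cardsD1 s) inE sE.
have := cardsID crossing (setX Es [set: bool]).
rewrite (setIidPr crossS) cEs -/inner.
have [t _ tS] := connect_to_sink s.
(* With $E$ early nodes, at most $2E - (E - 1) = E + 1$ edges cross, and a late sink gives $E + 1
   \le |V|$. *)
have : #|Es| < #|V|.
  rewrite -cardsT; apply/proper_card/properP; split; first exact: subsetT.
  by exists t; rewrite ?inE // early_sink.
move: #|Es| #|inner| #|crossing| #|_ :\ _| #|V|; lia.
Qed.

(** If the tails differ, the walk from the first to the second passes the late head of the first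
    edge, yet a node reaching an early node is early. If they agree, [x] determines the answer. *)
Lemma crossing_unique x e e' : e \in crossing -> e' \in crossing ->
  crosses e x -> crosses e' x -> e = e'.
Proof.
wlog uu' : e e' / connect (follows instr x) e.1 e'.1.
  move=> H eC e'C ex e'x.
  have /orP[uu'|u'u] : connect (follows instr x) e.1 e'.1 ||
                       connect (follows instr x) e'.1 e.1.
    case/andP: ex => su _; case/andP: e'x => su' _.
    exact: connect_functional (@follows_functional x) su su'.
  - exact: H.
  - by apply/esym; apply: H.
case: e e' uu' => [u b] [u' b'] /=; rewrite !inE /= /crosses /=.
move=> uu' /andP[uE vL] /andP[u'E _] /andP[_ ub] /andP[_ u'b'].
case/connect_step: uu' => [uu'|[v uv vu']].
  move: u'b'; rewrite -uu'; case: (queried _ u) ub => // i /eqP<- /eqP<-.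
  by [].
case/negP: vL; case/followsP: uv ub => i -> vE /eqP<-; rewrite -vE.
exact: early_connect (connect_follows_edge vu') u'E.
Qed.

Lemma crossing_exists x : early s -> exists2 e, e \in crossing & crosses e x.
Proof.
move=> sE; have [t /connectP[p]] := follows_to_sink (connect0 (follows instr x) s).
(* The start of the remaining walk becomes any early node [u] that [x] reaches from [s]; the
   induction stops at the first late node. *)
move: (connect0 (follows instr x) s) sE; move: {2 3 4 5}s => u.
elim: p u => [|v p IH] u su uE /=.
  by move=> _ -> /early_sink/negP.
case/andP=> uv vp lt tS; case vE: (early v).
  by apply: (IH v) => //; apply: connect_trans su (connect1 uv).
case/followsP: uv => i ui vE'; exists (u, x i).
  by rewrite inE /= uE -vE' vE.
by rewrite /crosses /= su ui eqxx.
Qed.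

(** * The rectangle partition given by the crossing edges *)

Lemma crossing_k_rectangle (phi : T -> nat) e : e \in crossing ->
  k_rectangle k (fun x => crosses e x * phi (f x)).
Proof.
rewrite inE => /andP[uE vL]; case: (early_queried uE) => i ui.
have uv : E e.1 (successor e.1 e.2) by apply/edgeP; exists i, e.2.
apply: (between_k_rectangle (disjoint_queried uv)).
(* An early tail has at least $n - k + 1$ variables queried from it on, which leaves at most $k$ of
   the $n + 1$ for those queried before. *)
- by have := card_queried e.1; move: uE; rewrite /early; lia.
- by rewrite leqNgt.
- move=> x y xy; rewrite /crosses ui => /andP[su xi].
  rewrite (connect_follows_before xy su) -xy //.
  by apply/queried_beforeP; exists e.1.
- move=> x y /crosses_connect sx /crosses_connect sy xy.
  by rewrite (value_after sx sy xy).
Qed.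

Lemma read_once_partition (phi : T -> nat) :
  exists2 r, r <= #|V| & rectangle_partition (phi \o f) k r.
Proof.
have [sE|sL] := boolP (early s); last first.
  (* When the source is late, at most $n - k$ variables are queried in all, so the whole function is
     one $k$-rectangle with a constant row factor. *)
  exists 1; first by apply/card_gt0P; exists s.
  exists (fun _ x => true * phi (f x)); split=> [_|i j|x].
  - apply: (@between_k_rectangle _ set0 (queried_after s)) => //.
    + by rewrite disjoints_subset sub0set.
    + by rewrite cards0.
    + by rewrite leqNgt.
    + by move=> x y _ _ xy; rewrite (@value_after x y s).
  - by rewrite !ord1.
  - by rewrite big_ord1 mul1n.
exists #|crossing|; first exact: card_crossing.
exists (fun i x => crosses (enum_val i) x * phi (f x)); split=> [i|i j ij x|x].
- exact/crossing_k_rectangle/enum_valP.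
- case ix: (crosses (enum_val i) x) => //; case jx: (crosses (enum_val j) x).
    case/eqP: ij; apply: enum_val_inj.
    exact: crossing_unique (enum_valP i) (enum_valP j) ix jx.
  by rewrite muln0.
- have [e eC ex] := crossing_exists x sE.
  rewrite (bigD1 (enum_rank_in eC e)) //= enum_rankK_in // ex mul1n.
  rewrite big1 ?addn0 // => i ie; case ix: (crosses _ x) => //.
  case/eqP: ie; apply: enum_val_inj; rewrite enum_rankK_in //.
  exact: crossing_unique (enum_valP i) eC ix ex.
Qed.

End ReadOnce.

(* [phi] relabels the sinks, so that a program for a Boolean function also
   bounds its negation. *)
Lemma Pplus_hat_le_BP1 n T (f : cube n -> T) (phi : T -> nat) :
  Pplus_hat (phi \o f) <= BP1 f.
Proof.
rewrite /BP1; case: ex_minnP => m /asboolP[B [B_ro B_f <-]] _.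
apply/bigmax_leqP => k _; rewrite /Pplus; case: ex_minnP => r _ r_min.
have [r' le_r' /asboolP/r_min le_rr'] :=
  read_once_partition B_ro B_f (ltn_ord k) phi.
exact: leq_trans le_rr' le_r'.
Qed.

Theorem theorem3p2 (n : nat) (hn : 1 <= n) :
  (forall f : cube n -> nat, Pplus_hat f <= BP1 f) /\
  (forall f : cube n -> bool, P_hat f <= BP1 f).
Proof.
split=> f; first exact: (Pplus_hat_le_BP1 f id).
rewrite /P_hat geq_max (Pplus_hat_le_BP1 f nat_of_bool).
exact: (Pplus_hat_le_BP1 f (fun b => ~~ b : nat)).
Qed.
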